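(* For every $\mathrm{CTL}^*_\pm$ state formula $\varphi$ over a set $AP$ of atomic propositions there is a counter-free visible $\mathrm{HTA}_\pm$ $\mathcal{A}_\varphi$ over $\Sigma=2^{AP}$ such that $\mathcal{L}(\varphi)=\mathcal{L}(\mathcal{A}_\varphi)$.
   Context: Fix a finite set $AP$, $\Sigma=2^{AP}$; $\Sigma$-trees are unranked (finitely many children per node), unordered, leafless trees labelled by $\Sigma$. $\mathrm{CTL}^*_\pm$: state formulae $\varphi ::= p\mid\neg\varphi\mid\varphi\lor\varphi\mid\mathsf{D}^n\varphi\mid\mathsf{E}\psi$, path formulae $\psi ::= \varphi\mid\psi\land\psi\mid\psi\lor\psi\mid\mathsf{X}\psi\mid\psi\,\mathsf{U}\,\psi$. At node $u$: $p$ iff $p\in t(u)$; Booleans usual; $\mathsf{D}^n\varphi$ iff at least $n$ distinct children of $u$ satisfy $\varphi$; $\mathsf{E}\psi$ iff some infinite path $\pi$ from the root has $\pi(i)=u$ and $(t,\pi,i)\models\psi$ (standard semantics for $\mathsf{X},\mathsf{U}$ on infinite paths). $\mathcal{L}(\varphi)$: trees whose root satisfies $\varphi$. $\mathrm{HTA}_\pm$: $\mathcal{A}=\langle Q,\Sigma,\delta,q_I,F\rangle$, $\delta:Q\times\Sigma\to\mathcal{B}^+(\{\Diamond_k,\Box_k\}_{k\in\mathbb{N}}\times Q)$ (positive Boolean formulae over atoms; $\Diamond=\Diamond_1,\Box=\Box_1$). Run on $t$ from $s$: tree $r$ labelled in $Q\times\mathrm{Dom}(t)$, root $(q_I,s)$,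 each node $x$ labelled $(q,v)$ satisfies $\delta(q,t(v))$, where $x\models(\Diamond_k,q')$ iff $x$ has children labelled $(q',v_i)$ for $k$ pairwise distinct children $v_i$ of $v$; $x\models(\Box_k,q')$ iff for all but at most $k-1$ children $v'$ of $v$ some child of $x$ is labelled $(q',v')$. Accepting: every infinite path of $r$ from its root visits $F$ infinitely often. $\mathcal{L}(\mathcal{A})$: trees with an accepting run from the root. $\mathcal{A}^\theta$: $\mathcal{A}$ with fresh initial state $q'$, $\delta(q',\sigma)=\theta$ for all $\sigma$. Hesitant: $Q$ partitioned into totally ordered nonempty components with transitions from $Q_i$ mentioning only states of components $Q_j$, $j\le i$; each component transient (no $Q_i$-atoms in its states' transitions), existential ($Q_i$-atoms only $(\Diamond,q')$, at most one per DNF clause) or universal ($Q_i$-atoms only $(\Box,q')$, at most one per CNF clause). Polarised: existential-component states $\notin F$, universal-component states $\in F$. Linearisation of a non-transient component $Q_i$ at $q\in Q_i$: with $B$ the set of atoms with state outside $Q_i$, $\mathcal{A}^q_{\mathrm{exit}}$ has states $Q_i\cup\{q_{\mathrm{exit}}\}$, alphabet $\Sigma\times2^B$, initial state $q$, and transitions $(q',(\sigma,C),q'')$ where: for existential $Q_i$, $q'=q''=q_{\mathrm{exit}}$, or $q'\in Q_i$, $q''=q_{\mathrm{exit}}$ and the DNF of $\delta(q',\sigma)$ has a clause $\bigwedge C$, or $q',q''\in Q_i$ and the DNF has a clause $(\Diamond,q'')\land\bigwedge C$; for universal $Q_i$ the same with CNF and clauses $\bigvee C$, $(\Box,q'')\lor\bigvee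 C$. A word automaton is counter-free if for every state $p$, finite word $u$, $n>0$, a path on $u^n$ from $p$ to $p$ implies one on $u$ from $p$ to $p$; $\mathcal{A}$ is counter-free if all its linearisations are. $Q_i$ is visible if for each $q\in Q_i$ and all distinct annotations $C\ne C'$ occurring in transitions of $\mathcal{A}^q_{\mathrm{exit}}$ with source in $Q_i$, there exist $\theta\in C$, $\theta'\in C'$ with $\mathcal{L}(\mathcal{A}^\theta)$ and $\mathcal{L}(\mathcal{A}^{\theta'})$ complementary; $\mathcal{A}$ is visible if every non-transient component is visible. *)

(* Defs.v *)
From HB Require Import structures.
From mathcomp Require Import all_boot.
Set Implicit Arguments. Unset Strict Implicit. Unset Printing Implicit Defensive.

(* The children order carries no meaning: all notions below only use the   *)
(* SET of children, so this represents unordered trees.                     *)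
Section Trees.
Variable AP : finType.

Record tree := Tree {
  arity : seq nat -> nat;
  label : seq nat -> {set AP};
  arity_pos : forall u, 0 < arity u }.

Definition in_dom (t : tree) (u : seq nat) : Prop :=
  forall k, k < size u -> nth 0 u k < arity t (take k u).

Definition is_tpath (t : tree) (pi : nat -> seq nat) : Prop :=
  pi 0 = [::] /\
  forall i, exists j, j < arity t (pi i) /\ pi i.+1 = rcons (pi i) j.

Inductive sform :=
  | SAtom of AP
  | SNot of sform
  | SOr of sform & sform
  | SD of nat & sform
  | SE of pform
with pform :=
  | PState of sform
  | PConj of pform & pform
  | PDisj of pform & pform
  | PX of pform
  | PU of pform & pform.

Fixpoint ssat (t : tree) (f : sform) (u : seq nat) {struct f} : Prop :=
  match f with
  | SAtom p => p \in label t u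
  | SNot g => ~ ssat t g u
  | SOr g h => ssat t g u \/ ssat t h u
  | SD n g => exists s : seq nat,
      [/\ uniq s, n <= size s &
          forall i, i \in s -> i < arity t u /\ ssat t g (rcons u i)]
  | SE p => exists (pi : nat -> seq nat) (i : nat),
      [/\ is_tpath t pi, pi i = u & psat t p pi i]
  end
with psat (t : tree) (p : pform) (pi : nat -> seq nat) (i : nat) {struct p}
    : Prop :=
  match p with
  | PState f => ssat t f (pi i)
  | PConj p1 p2 => psat t p1 pi i /\ psat t p2 pi i
  | PDisj p1 p2 => psat t p1 pi i \/ psat t p2 pi i
  | PX p1 => psat t p1 pi i.+1
  | PU p1 p2 => exists k, [/\ i <= k, psat t p2 pi k &
                             forall j, i <= j < k -> psat t p1 pi j]
  end.

Definition lang_formula (phi : sform) (t : tree) : Prop := ssat t phi [::].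

End Trees.

Inductive modal := Dia of nat | Box of nat.

Definition modal_to (m : modal) : bool * nat :=
  match m with Dia k => (true, k) | Box k => (false, k) end.
Definition modal_of (p : bool * nat) : modal :=
  if p.1 then Dia p.2 else Box p.2.
Lemma modal_toK : cancel modal_to modal_of. Proof. by case. Qed.
HB.instance Definition _ := Equality.copy modal (can_type modal_toK).

Definition atom (Q : Type) := (modal * Q)%type.

Inductive pbf (A : Type) :=
  | BTrue | BFalse | BAtom of A | BAnd of pbf A & pbf A | BOr of pbf A & pbf A.
Arguments BTrue {A}. Arguments BFalse {A}.

Fixpoint pbf_sat A (P : A -> Prop) (f : pbf A) : Prop :=
  match f with
  | BTrue => True | BFalse => False | BAtom a => P a
  | BAnd f g => pbf_sat P f /\ pbf_sat P g
  | BOr f g => pbf_sat P f \/ pbf_sat P g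
  end.

Fixpoint pbf_map A B (h : A -> B) (f : pbf A) : pbf B :=
  match f with
  | BTrue => BTrue | BFalse => BFalse | BAtom a => BAtom (h a)
  | BAnd f g => BAnd (pbf_map h f) (pbf_map h g)
  | BOr f g => BOr (pbf_map h f) (pbf_map h g)
  end.

Fixpoint pbf_atoms A (f : pbf A) : seq A :=
  match f with
  | BTrue | BFalse => [::] | BAtom a => [:: a]
  | BAnd f g | BOr f g => pbf_atoms f ++ pbf_atoms g
  end.

(* disjunctive / conjunctive normal forms (by distribution); a clause is a
   list of atoms, read as the SET of its atoms *)
Fixpoint dnf A (f : pbf A) : seq (seq A) :=
  match f with
  | BTrue => [:: [::]] | BFalse => [::] | BAtom a => [:: [:: a]]
  | BOr f g => dnf f ++ dnf g
  | BAnd f g => [seq c1 ++ c2 | c1 <- dnf f, c2 <- dnf g]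
  end.
Fixpoint cnf A (f : pbf A) : seq (seq A) :=
  match f with
  | BTrue => [::] | BFalse => [:: [::]] | BAtom a => [:: [:: a]]
  | BAnd f g => cnf f ++ cnf g
  | BOr f g => [seq c1 ++ c2 | c1 <- cnf f, c2 <- cnf g]
  end.

Section Automata.
Variable AP : finType.

Record ata (Q : finType) := ATA {
  delta : Q -> {set AP} -> pbf (atom Q);
  qI : Q;
  accF : {set Q} }.

(* run trees: nodes are nat-addresses in a prefix-closed domain rdom,
   labelled by rlab in Q x Dom(t) *)
Record run (Q : Type) := Run {
  rdom : seq nat -> Prop;
  rlab : seq nat -> Q * seq nat }.

Variable Q : finType.
Implicit Types (A : ata Q) (t : tree AP) (r : run Q).

Definition has_child_lab r (x : seq nat) (l : Q * seq nat) : Prop :=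
  exists j, rdom r (rcons x j) /\ rlab r (rcons x j) = l.

Definition atom_holds t r (x : seq nat) (a : atom Q) : Prop :=
  let v := (rlab r x).2 in
  match a.1 with
  | Dia k => exists s : seq nat,
      [/\ uniq s, size s = k &
          forall i, i \in s -> i < arity t v /\ has_child_lab r x (a.2, rcons v i)]
  | Box k => exists s : seq nat,
      [/\ uniq s, size s < k &
          forall i, i < arity t v -> i \notin s ->
                    has_child_lab r x (a.2, rcons v i)]
  end.

Definition is_run_from A t (s : seq nat) r : Prop :=
  [/\ rdom r [::],
      (forall x j, rdom r (rcons x j) -> rdom r x),
      rlab r [::] = (qI A, s) &
      forall x, rdom r x ->
        in_dom t (rlab r x).2 /\
        pbf_sat (atom_holds t r x) (delta A (rlab r x).1 (label t (rlab r x).2))].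

Definition accepting A r : Prop :=
  forall rho : nat -> seq nat,
    rho 0 = [::] ->
    (forall n, rdom r (rho n.+1) /\ exists j, rho n.+1 = rcons (rho n) j) ->
    forall N, exists n, N <= n /\ (rlab r (rho n)).1 \in accF A.

Definition accepts A t : Prop :=
  exists r, is_run_from A t [::] r /\ accepting A r.

End Automata.

Definition with_init (AP Q : finType) (A : ata AP Q) (th : atom Q)
    : ata AP (option Q) :=
  {| delta := fun q s => match q with
       | None => BAtom (th.1, Some th.2)
       | Some q => pbf_map (fun a : atom Q => (a.1, Some a.2)) (delta A q s)
       end;
     qI := None;
     accF := Some @: accF A |}.

Definition complementary (AP Q1 Q2 : finType) (A1 : ata AP Q1) (A2 : ata AP Q2)
  : Prop := forall t : tree AP, accepts A1 t <-> ~ accepts A2 t.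

(* Hesitant structure: Q_i = {q | comp q = i}, ordered by i (only nonempty  *)
(* indices, i.e. those in the image of comp, are components).               *)
Inductive ckind := Transient | Existential | Universal.

Record hpart (Q : Type) := HPart { comp : Q -> nat; kind : nat -> ckind }.

Section Hesitant.
Variables (AP Q : finType) (A : ata AP Q) (H : hpart Q).

Definition inside (i : nat) (a : atom Q) : bool := comp H a.2 == i.

Definition hesitant : Prop :=
  forall (q : Q) (s : {set AP}),
    let i := comp H q in
    let f := delta A q s in
    (forall a, a \in pbf_atoms f -> comp H a.2 <= i) /\
    match kind H i with
    | Transient => forall a, a \in pbf_atoms f -> ~~ inside i a
    | Existential =>
        (forall a, a \in pbf_atoms f -> inside i a -> a.1 = Dia 1) /\
        (forall cl, cl \in dnf f -> size (undup (filter (inside i) cl)) <= 1)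
    | Universal =>
        (forall a, a \in pbf_atoms f -> inside i a -> a.1 = Box 1) /\
        (forall cl, cl \in cnf f -> size (undup (filter (inside i) cl)) <= 1)
    end.

Definition polarised : Prop :=
  forall q : Q,
    (kind H (comp H q) = Existential -> q \notin accF A) /\
    (kind H (comp H q) = Universal -> q \in accF A).

(* Linearisation A^q_exit of component i: states Some q (q in Q_i) and
   None (= q_exit); letters (sigma, C) with C a finite set of atoms in B
   (given as a list, read up to set equality =i). *)
Definition letter := ({set AP} * seq (atom Q))%type.

Definition lin_trans (i : nat) (p : option Q) (l : letter) (p' : option Q)
    : Prop :=
  let C := l.2 in
  all (fun a => ~~ inside i a) C /\
  match kind H i with
  | Transient => False
  | _ =>
    let nf := fun f => if kind H i is Existential then dnf f else cnf f in
    let m1 := if kind H i is Existential then Dia 1 else Box 1 in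
    match p, p' with
    | None, None => True
    | Some q', None =>
        comp H q' = i /\
        exists cl, cl \in nf (delta A q' l.1) /\
                   all (fun a => ~~ inside i a) cl /\ cl =i C
    | Some q', Some q'' =>
        [/\ comp H q' = i, comp H q'' = i &
        exists cl, [/\ cl \in nf (delta A q' l.1),
                       filter (inside i) cl =i [:: (m1, q'')] &
                       filter (fun a => ~~ inside i a) cl =i C]]
    | None, Some _ => False
    end
  end.

Fixpoint lin_path (i : nat) (p : option Q) (w : seq letter) (p' : option Q)
    : Prop :=
  match w with
  | [::] => p = p'
  | a :: w' => exists p1, lin_trans i p a p1 /\ lin_path i p1 w' p'
  end.

Definition lin_state (i : nat) (p : option Q) : Prop :=
  match p with None => True | Some q => comp H q = i end.

(* counter-freeness of the linearisation of component i (at any q in Q_i;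
   the definition does not depend on the initial state) *)
Definition lin_counter_free (i : nat) : Prop :=
  forall p, lin_state i p ->
  forall (u : seq letter) (n : nat), 0 < n ->
    lin_path i p (flatten (nseq n u)) p -> lin_path i p u p.

Definition counter_free : Prop :=
  forall q : Q, kind H (comp H q) <> Transient -> lin_counter_free (comp H q).

Definition annotation (i : nat) (C : seq (atom Q)) : Prop :=
  exists (q' : Q) (s : {set AP}) (p'' : option Q),
    comp H q' = i /\ lin_trans i (Some q') (s, C) p''.

Definition visible : Prop :=
  forall q : Q, kind H (comp H q) <> Transient ->
  forall C C' : seq (atom Q),
    annotation (comp H q) C -> annotation (comp H q) C' -> ~ (C =i C') ->
    exists th th', [/\ th \in C, th' \in C' &
                    complementary (with_init A th) (with_init A th')].

End Hesitant.

(* Main.v *)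
Require Import Defs.
From HB Require Import structures.
From mathcomp Require Import all_boot boolp.
Set Implicit Arguments. Unset Strict Implicit. Unset Printing Implicit Defensive.

(**
The path formulae are built from state formulae by conjunction, disjunction, X
and U only.  Hence the truth values at position [i] of all path subformulae are
a function [upd a] of the letter [a] at [i] and of the truth values at [i + 1],
and a true formula is forced by a finite prefix of the path.  Running this
backward computation forward gives a deterministic automaton: its states are the
sets [f] of valuations, a letter [a] maps [f] to the preimage of [f] under
[upd a], and the run exits as soon as [f] is the set of all valuations.  The
maps [upd w] are aperiodic, so the automaton is counter-free.

A letter consists of a node label and a complete truth assignment to the graded
atoms of lower rank (nesting depth of E and D), from which the state subformulae
are evaluated.  A positive state is the disjunction over all assignments of the
conjunction of the corresponding literals with a move to the next state; the
negative states are the exact duals.  Annotations are then complete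
assignments, so two distinct ones contain a complementary pair of literals.
State formulae [g] are treated as the path formulae [PState g], so that there
are no transient components.
*)

(** * Classical equality and mutual induction for formulae *)

HB.instance Definition _ (AP : finType) := gen_eqMixin (pform AP).
HB.instance Definition _ (AP : finType) := gen_choiceMixin (pform AP).

Scheme sform_mut := Induction for sform Sort Prop
  with pform_mut := Induction for pform Sort Prop.
Combined Scheme sform_pform_ind from sform_mut, pform_mut.

(** * Formulae given by their clauses *)

Section NormalForms.
Variable A : eqType.
Implicit Types (c : seq A) (cls : seq (seq A)).

(** The shape is chosen so that [dnf] gives back exactly the list [cls], and dually for [cnf_pbf];
    hesitancy and the linearisations can then be read off the clauses. *)
Definition dnf_pbf cls : pbf A :=
  foldr (fun c => BOr (foldr (fun a => BAnd (BAtom a)) BTrue c)) BFalse cls.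
Definition cnf_pbf cls : pbf A :=
  foldr (fun c => BAnd (foldr (fun a => BOr (BAtom a)) BFalse c)) BTrue cls.

Lemma dnf_dnf_pbf cls : dnf (dnf_pbf cls) = cls.
Proof.
elim: cls => //= c cls ->.
suff -> : dnf (foldr (fun a => BAnd (BAtom a)) BTrue c) = [:: c] by [].
by elim: c => //= a c ->.
Qed.

Lemma cnf_cnf_pbf cls : cnf (cnf_pbf cls) = cls.
Proof.
elim: cls => //= c cls ->.
suff -> : cnf (foldr (fun a => BOr (BAtom a)) BFalse c) = [:: c] by [].
by elim: c => //= a c ->.
Qed.

Lemma atoms_dnf_pbf cls : pbf_atoms (dnf_pbf cls) = flatten cls.
Proof. by elim: cls => //= c cls ->; congr cat; elim: c => //= a c ->. Qed.

Lemma atoms_cnf_pbf cls : pbf_atoms (cnf_pbf cls) = flatten cls.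
Proof. by elim: cls => //= c cls ->; congr cat; elim: c => //= a c ->. Qed.

Lemma pbf_sat_dnf (P : A -> Prop) cls :
  pbf_sat P (dnf_pbf cls) <->
  exists c, c \in cls /\ forall a, a \in c -> P a.
Proof.
have satc c : pbf_sat P (foldr (fun a => BAnd (BAtom a)) BTrue c) <->
    forall a, a \in c -> P a.
  elim: c => [|a c IH] /=; first by split.
  split=> [[Pa /IH Pc] b|Pc]; first by rewrite inE => /orP[/eqP->|/Pc].
  by split; [apply: Pc; rewrite mem_head | apply/IH => b bc; apply: Pc; rewrite inE bc orbT].
elim: cls => [|c cls IH] /=; first by split=> // -[? []].
split=> [[/satc Pc|/IH[d [dc Pd]]]|[d []]].
- by exists c; rewrite mem_head.
- by exists d; rewrite inE dc orbT.
by rewrite inE => /orP[/eqP->|dc] Pd; [left; apply/satc | right; apply/IH; exists d].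
Qed.

Lemma pbf_sat_cnf (P : A -> Prop) cls :
  pbf_sat P (cnf_pbf cls) <->
  forall c, c \in cls -> exists a, a \in c /\ P a.
Proof.
have satc c : pbf_sat P (foldr (fun a => BOr (BAtom a)) BFalse c) <->
    exists a, a \in c /\ P a.
  elim: c => [|a c IH] /=; first by split=> // -[? []].
  split=> [[Pa|/IH[b [bc Pb]]]|[b []]].
  - by exists a; rewrite mem_head.
  - by exists b; rewrite inE bc orbT.
  by rewrite inE => /orP[/eqP->|bc] Pb; [left | right; apply/IH; exists b].
elim: cls => [|c cls IH] /=; first by split.
split=> [[/satc Pc /IH Pcls] d|Pcls]; first by rewrite inE => /orP[/eqP->|/Pcls].
split; first by apply/satc/Pcls; rewrite mem_head.
by apply/IH => d dc; apply: Pcls; rewrite inE dc orbT.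
Qed.

End NormalForms.

Lemma pbf_sat_map A B (h : A -> B) (P : B -> Prop) f :
  pbf_sat P (pbf_map h f) = pbf_sat (P \o h) f.
Proof. by elim: f => //= f -> g ->. Qed.

Lemma pbf_map_id A (f : pbf A) : pbf_map id f = f.
Proof. by elim: f => //= f -> g ->. Qed.

Lemma pbf_sat_mono A (P R : A -> Prop) f :
  (forall a, P a -> R a) -> pbf_sat P f -> pbf_sat R f.
Proof.
move=> PR; elim: f => //= [f IHf g IHg [/IHf ? /IHg ?]|f IHf g IHg [/IHf|/IHg]] //.
- by left.
- by right.
Qed.

(** * Paths of a tree and counting of children *)

Section TreePaths.
Variables (AP : finType) (t : tree AP).
Implicit Types (u v : seq nat) (pi : nat -> seq nat).

Lemma in_dom_rcons u i : in_dom t (rcons u i) <-> in_dom t u /\ i < arity t u.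
Proof.
split=> [D|[D ilt] k].
  split=> [k klt|].
    have := D k; rewrite size_rcons nth_rcons klt ltnS (ltnW klt) => /(_ isT).
    by rewrite -cats1 takel_cat // ltnW.
  have := D (size u); rewrite size_rcons nth_rcons ltnn eqxx ltnSn => /(_ isT).
  by rewrite -cats1 take_size_cat.
rewrite size_rcons ltnS leq_eqVlt => /orP[/eqP->|klt].
  by rewrite nth_rcons ltnn eqxx -cats1 take_size_cat.
by rewrite nth_rcons klt -cats1 takel_cat ?(ltnW klt) //; apply: D.
Qed.

Lemma size_tpath pi : is_tpath t pi -> forall i, size (pi i) = i.
Proof.
case=> pi0 piS; elim=> [|i IH]; first by rewrite pi0.
by have [j [_ ->]] := piS i; rewrite size_rcons IH.
Qed.

Lemma in_dom_tpath pi : is_tpath t pi -> forall i, in_dom t (pi i).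
Proof.
case=> pi0 piS; elim=> [|i IH]; first by rewrite pi0.
by have [j [jlt ->]] := piS i; apply/in_dom_rcons.
Qed.

Lemma tpath_through u : in_dom t u ->
  exists pi, is_tpath t pi /\ pi (size u) = u.
Proof.
(* The path descends to [u] and then always takes child 0, which exists by [arity_pos]. *)
move=> D; exists (fun k => take k u ++ nseq (k - size u) 0).
split; last by rewrite take_size subnn cats0.
split=> [|i]; first by rewrite take0 sub0n.
have [ilt|leu] := ltnP i (size u).
  exists (nth 0 u i); rewrite (take_nth 0) //.
  have -> : i - size u = 0 by apply/eqP; rewrite subn_eq0 ltnW.
  have -> : i.+1 - size u = 0 by apply/eqP; rewrite subn_eq0.
  by rewrite !cats0; split=> //; apply: D.
exists 0; split; first exact: arity_pos.
rewrite !take_oversize ?(leqW leu) // subSn // -cats1 -catA; congr cat.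
by rewrite cats1 -[_.+1]addn1 nseqD cats1.
Qed.

Definition count_children (P : seq nat -> Prop) u :=
  count (fun i => `[< P (rcons u i) >]) (iota 0 (arity t u)).

(** The conditions of [atom_holds] with an arbitrary predicate in place of the labels of a run, so
    that runs and semantics can be compared by monotonicity. *)
Definition atom_sem (Q : Type) (P : Q -> seq nat -> Prop) u (a : atom Q) : Prop :=
  match a.1 with
  | Dia k => exists s : seq nat,
      [/\ uniq s, size s = k &
          forall i, i \in s -> i < arity t u /\ P a.2 (rcons u i)]
  | Box k => exists s : seq nat,
      [/\ uniq s, size s < k &
          forall i, i < arity t u -> i \notin s -> P a.2 (rcons u i)]
  end.

Lemma count_childrenP P u n :
  (exists s : seq nat, [/\ uniq s, n <= size s &
      forall i, i \in s -> i < arity t u /\ P (rcons u i)])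
  <-> n <= count_children P u.
Proof.
rewrite /count_children -size_filter.
set c := [seq _ <- _ | _].
have cP i : i \in c <-> i < arity t u /\ P (rcons u i).
  by rewrite mem_filter mem_iota /= add0n; split=> [/andP[/asboolP ? ?]|[? ?]] //;
     apply/andP; split=> //; apply/asboolP.
split=> [[s [us ns sP]]|nc].
  by apply: leq_trans ns _; apply: uniq_leq_size => // i /sP/cP.
by exists c; rewrite filter_uniq ?iota_uniq //; split=> // i /cP.
Qed.

Lemma atom_sem_Dia Q (P : Q -> seq nat -> Prop) u n q :
  atom_sem P u (Dia n, q) <-> n <= count_children (P q) u.
Proof.
split=> [[s [us sn sP]]|/count_childrenP[s [us ns sP]]].
  by apply/count_childrenP; exists s; rewrite sn.
exists (take n s); rewrite take_uniq // size_takel //; split=> // i /mem_take.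
exact: sP.
Qed.

Lemma atom_sem_Box Q (P : Q -> seq nat -> Prop) u n q :
  atom_sem P u (Box n, q) <-> count_children (fun w => ~ P q w) u < n.
Proof.
split=> [[s [us sn sP]]|].
  apply: leq_ltn_trans sn; rewrite /count_children -size_filter.
  apply: uniq_leq_size; first by rewrite filter_uniq ?iota_uniq.
  move=> i; rewrite mem_filter mem_iota /= add0n => /andP[/asboolP nP ilt].
  by case: (boolP (i \in s)) => // /(sP _ ilt).
rewrite /count_children -size_filter => nlt.
exists [seq i <- iota 0 (arity t u) | `[< ~ P q (rcons u i) >]].
rewrite filter_uniq ?iota_uniq //; split=> // i ilt.
rewrite mem_filter mem_iota /= add0n ilt andbT => /asboolP; exact: contrapT.
Qed.

Lemma atom_sem_mono Q (P R : Q -> seq nat -> Prop) u a :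
  (forall i, i < arity t u -> P a.2 (rcons u i) -> R a.2 (rcons u i)) ->
  atom_sem P u a -> atom_sem R u a.
Proof.
case: a => [[n|n] q] /= PR [s [us sn sP]]; exists s; split=> // i.
  by move=> /sP[ilt Pi]; split=> //; apply: PR.
by move=> ilt /(sP _ ilt); apply: PR.
Qed.

Lemma eq_count_children (P R : seq nat -> Prop) u :
  (forall i, i < arity t u -> P (rcons u i) <-> R (rcons u i)) ->
  count_children P u = count_children R u.
Proof.
move=> PR; apply: eq_in_count => i; rewrite mem_iota /= add0n => ilt.
by apply/asboolP/asboolP => /PR; apply.
Qed.

End TreePaths.

(** * Nesting depth of D and E *)

Section Ranks.
Variable AP : finType.

Fixpoint srank (g : sform AP) : nat :=
  match g with
  | SAtom _ => 0
  | SNot g => srank g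
  | SOr g h => maxn (srank g) (srank h)
  | SD _ g => (srank g).+1
  | SE p => (prank p).+1
  end
with prank (p : pform AP) : nat :=
  match p with
  | PState g => srank g
  | PX p => prank p
  | PConj p q | PDisj p q | PU p q => maxn (prank p) (prank q)
  end.

End Ranks.

(** * The backward valuation and its aperiodicity *)

Section Automaton.
Variables (AP : finType) (PF : seq (pform AP)) (N M : nat).

Definition pval : finType := {set seq_sub PF}.
Definition pred_pval : finType := {set pval}.
(** [(n, (k, f))] codes the graded atom asking for at least [n] children that satisfy state [f] of
    rank [k]. *)
Definition base : finType := ('I_N.+1 * ('I_M.+1 * pred_pval))%type.
Definition lett : Type := ({set AP} * {set base})%type.
Implicit Types (v : pval) (f : pred_pval) (a : lett) (p q : pform AP).

Definition look v p : bool := if insub p is Some x then x \in v else false.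

Definition init p : pred_pval := [set v | look v p].

Definition below k : {set base} := [set x : base | x.2.1 < k].

(** The part of a letter that the automaton of rank [k] reads. *)
Definition mask_letter k a : lett := (a.1, a.2 :&: below k).

(** The [SE] case unfolds one step of the automaton of rank [prank p]: for [p] in [PF], [f] is its
    state after reading the current letter from [init p]; either it exits or some child continues
    from [f]. *)
Fixpoint seval a (g : sform AP) {struct g} : bool :=
  match g with
  | SAtom x => x \in a.1
  | SNot g => ~~ seval a g
  | SOr g h => seval a g || seval a h
  | SD n g => (inord n, (inord (srank g), init (PState g))) \in a.2
  | SE p => let f : pred_pval := [set v | peval (mask_letter (prank p) a) v p] in
            (f == setT) || ((inord 1, (inord (prank p), f)) \in a.2)
  end
with peval a v p {struct p} : bool :=
  match p with
  | PState g => seval a g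
  | PConj p q => peval a v p && peval a v q
  | PDisj p q => peval a v p || peval a v q
  | PX p => look v p
  | PU p q => peval a v q || (peval a v p && look v (PU p q))
  end.

Definition upd a v : pval := [set x | peval a v (ssval x)].

Definition act f a : pred_pval := [set v | upd a v \in f].

(** Guards the default values: [look] is false outside [PF], and [inord] does not represent grades
    above [N]. *)
Fixpoint supported_s (g : sform AP) : bool :=
  match g with
  | SAtom _ => true
  | SNot g => supported_s g
  | SOr g h => supported_s g && supported_s h
  | SD n g => [&& n <= N, PState g \in PF & supported_s g]
  | SE p => supported_p p
  end
with supported_p p : bool :=
  (p \in PF) &&
  match p with
  | PState g => supported_s g
  | PX p => supported_p p
  | PConj p q | PDisj p q | PU p q => supported_p p && supported_p q
  end.

Lemma supported_p_mem p : supported_p p -> p \in PF.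
Proof. by case: p => [?|? ?|? ?|?|? ?] /= /andP[]. Qed.

Lemma lookE v (x : seq_sub PF) : look v (ssval x) = (x \in v).
Proof. by rewrite /look (valK x). Qed.

Lemma look_upd a v p : p \in PF -> look (upd a v) p = peval a v p.
Proof. by move=> pPF; rewrite -[p]/(ssval (SeqSub pPF)) lookE inE. Qed.

Lemma act_init p a : p \in PF -> act (init p) a = [set v | peval a v p].
Proof. by move=> pPF; apply/setP => v; rewrite !inE look_upd. Qed.

Definition upds (w : seq lett) v : pval := foldr upd v w.
Definition acts f (w : seq lett) : pred_pval := foldl act f w.

(** Reading forward composes preimages: the letter read first is the last one applied by the
    backward map [upds]. *)
Lemma actsE f w : acts f w = [set v | upds w v \in f].
Proof.
elim: w f => [|a w IH] f; first by apply/setP => v; rewrite inE.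
by rewrite /= IH; apply/setP => v; rewrite !inE.
Qed.

Lemma upds_cat w1 w2 v : upds (w1 ++ w2) v = upds w1 (upds w2 v).
Proof. exact: foldr_cat. Qed.

(** All suffixes [s2], that is all positions within a round, are included because the value of
    [PX p] at one position is that of [p] at the next. *)
Definition stable (w : seq lett) p (n : nat) :=
  forall m, n <= m -> forall v s1 s2, w = s1 ++ s2 ->
  look (upds s2 (iter m (upds w) v)) p = look (upds s2 (iter m.+1 (upds w) v)) p.

(** The empty suffix in round [m.+1] is the full suffix [w] in round [m], whence one extra round. *)
Lemma stable_nonempty w p n :
  (forall m, n <= m -> forall v s1 a s2, w = s1 ++ a :: s2 ->
     look (upds (a :: s2) (iter m (upds w) v)) p =
     look (upds (a :: s2) (iter m.+1 (upds w) v)) p) ->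
  stable w p n.+1.
Proof.
move=> st m nm v s1 [|a s2] def_w; last by apply: st def_w; apply: ltnW.
case: m nm => // m nm; rewrite !iterS.
case: w st def_w => [|b w] st _ //.
exact: (st m nm v [::] b w).
Qed.

(* Aperiodicity.  In the [PU] case one round through [w] acts on the truth value
   [x] of the until formula as [x |-> B || (A && x)], which is idempotent. *)
Lemma stable_ex w p : supported_p p -> exists n, stable w p n.
Proof.
elim: p => [g|p IHp q IHq|p IHp q IHq|p IHp|p IHp q IHq] sup;
  have pPF := supported_p_mem sup; case/andP: (sup) => _ /= sup'.
- exists 1; apply: stable_nonempty => m _ v s1 a s2 _.
  by rewrite !(look_upd _ _ pPF).
- case/andP: sup' => sp sq; have [n1 st1] := IHp sp; have [n2 st2] := IHq sq.
  exists (maxn n1 n2).+1; apply: stable_nonempty => m.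
  rewrite geq_max => /andP[m1 m2] v s1 a s2 def_w.
  have := st1 m m1 v s1 _ def_w; have := st2 m m2 v s1 _ def_w.
  by rewrite !look_upd ?(supported_p_mem sp) ?(supported_p_mem sq) //= => -> ->.
- case/andP: sup' => sp sq; have [n1 st1] := IHp sp; have [n2 st2] := IHq sq.
  exists (maxn n1 n2).+1; apply: stable_nonempty => m.
  rewrite geq_max => /andP[m1 m2] v s1 a s2 def_w.
  have := st1 m m1 v s1 _ def_w; have := st2 m m2 v s1 _ def_w.
  by rewrite !look_upd ?(supported_p_mem sp) ?(supported_p_mem sq) //= => -> ->.
- have [n st] := IHp sup'; exists n.+1; apply: stable_nonempty => m nm v s1 a s2 def_w.
  rewrite !(look_upd _ _ pPF) /=.
  by apply: (st m nm v (rcons s1 a)); rewrite cat_rcons.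
case/andP: sup' => sp sq; have [n1 st1] := IHp sp; have [n2 st2] := IHq sq.
pose n := maxn n1 n2.
pose x m v s := look (upds s (iter m (upds w) v)) (PU p q).
have stn r : (forall m, n <= m -> forall v s1 s2, w = s1 ++ s2 ->
    look (upds s2 (iter m (upds w) v)) r = look (upds s2 (iter m.+1 (upds w) v)) r) ->
  forall m, n <= m -> forall v s1 s2, w = s1 ++ s2 ->
    look (upds s2 (iter m (upds w) v)) r = look (upds s2 (iter n (upds w) v)) r.
  move=> st m nm v s1 s2 def_w; rewrite -(subnK nm).
  elim: (m - n) => // k IH; rewrite addSn -IH; symmetry.
  by apply: (st _ _ v s1) => //; rewrite leq_addl.
have {}st1 := stn p (fun m nm => st1 m (leq_trans (leq_maxl _ _) nm)).
have {}st2 := stn q (fun m nm => st2 m (leq_trans (leq_maxr _ _) nm)).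
(* [A] and [B] depend on [v] and the suffix but not on [m]: they use the values of [p] and [q] in
   round [n], from which on these are stable. *)
have affine v s1 s2 : w = s1 ++ s2 ->
    exists A B, forall m, n <= m -> x m v s2 = B || (A && x m v [::]).
  elim: s2 s1 => [|a s2 IH] s1 def_w; first by exists true, false.
  have [|A [B AB]] := IH (rcons s1 a); first by rewrite cat_rcons.
  set y := iter n (upds w) v.
  pose P := look (upds (a :: s2) y) p; pose R := look (upds (a :: s2) y) q.
  exists (P && A), (R || P && B) => m nm.
  have := st1 m nm v _ _ def_w; have := st2 m nm v _ _ def_w.
  rewrite {1}/x !(look_upd _ _ pPF) /= -/(x m v s2) (AB m nm).
  rewrite /R /P !look_upd ?(supported_p_mem sp) ?(supported_p_mem sq) //= => -> ->.
  by rewrite andb_orr orbA andbA.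
exists n.+1 => m nm v s1 s2 def_w; rewrite -!/(x _ v s2).
have [A [B AB]] := affine v s1 s2 def_w.
have [A' [B' AB']] := affine v [::] w erefl.
have nm' := ltnW nm.
suff xx : x m v [::] = x m.+1 v [::] by rewrite !AB ?leqW // xx.
case: m nm {nm'} => // m nm.
have xS k : x k.+1 v [::] = x k v w by rewrite /x iterS.
rewrite (xS m.+1) AB' // ?leqW // xS AB' //.
by move: (x m v [::]) => y {AB'}; case: A' B' y => [] [] [].
Qed.

Hypothesis PF_supported : forall p, p \in PF -> supported_p p.

Lemma upds_aperiodic w :
  exists n, forall m, n <= m -> forall v, iter m.+1 (upds w) v = iter m (upds w) v.
Proof.
have [h hP] : {h : pform AP -> nat & forall p, p \in PF -> stable w p (h p)}.
  apply/cid; have /choice[h hP] : forall p, exists n, p \in PF -> stable w p n.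
    move=> p; case: (boolP (p \in PF)) => [pPF|_]; last by exists 0.
    by have [n st] := stable_ex w (PF_supported pPF); exists n.
  by exists h.
exists (\max_(x : seq_sub PF) h (ssval x)) => m le_m v; apply/setP => x.
rewrite -!lookE; symmetry; apply: (hP _ (ssvalP x) m _ v w [::]); last by rewrite cats0.
exact: leq_trans (leq_bigmax _) le_m.
Qed.

Lemma upds_flatten_nseq n w v : upds (flatten (nseq n w)) v = iter n (upds w) v.
Proof. by elim: n => //= n IH; rewrite upds_cat IH. Qed.

(** Let [T] be [upds w]. The hypothesis makes [f] its own preimage under every [T^(j n)]. For large
    [j] aperiodicity gives [T^(j n + 1) = T^(j n)], so the preimage of [f] under [T] is [f] too. *)
Lemma acts_counter_free f w n :
  0 < n -> acts f (flatten (nseq n w)) = f -> acts f w = f.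
Proof.
move=> n0 fn; have [K apK] := upds_aperiodic w.
have fnK j : [set v | iter (j * n) (upds w) v \in f] = f.
  elim: j => [|j IH]; first by apply/setP => v; rewrite inE.
  apply/setP => v; rewrite inE mulSn iterD -upds_flatten_nseq.
  by rewrite -[in RHS]IH -[in RHS]fn actsE !inE upds_flatten_nseq -!iterD addnC.
rewrite actsE; apply/setP => v; rewrite inE -[in LHS](fnK K) inE -iterSr.
by rewrite apK -1?{2}(fnK K) ?inE // leq_pmulr.
Qed.

End Automaton.

(** * The forward automaton on a tree computes E *)

Section Semantics.
Variables (AP : finType) (PF : seq (pform AP)) (N M : nat) (t : tree AP).
Notation F := (pred_pval PF).
Notation base := (base PF N M).
Notation lett := (lett PF N M).
Implicit Types (f : F) (u : seq nat) (p q : pform AP) (pi : nat -> seq nat).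

Definition letter_of (S : nat -> F -> seq nat -> Prop) k u : lett :=
  (label t u,
   [set x : base | (x.2.1 < k) && (x.1 <= count_children t (S x.2.1 x.2.2) u)]).

(** [d] bounds the moves made before the exit; it later serves as the decreasing counter of a
    run. *)
Fixpoint reach (l : seq nat -> lett) d f u : Prop :=
  act f (l u) = setT \/
  if d is d'.+1 then
    exists i, i < arity t u /\ reach l d' (act f (l u)) (rcons u i)
  else False.

(* Course-of-values recursion on the rank. *)
Fixpoint sem_upto K : nat -> F -> seq nat -> Prop :=
  if K is K'.+1 then fun k =>
    if k < K' then sem_upto K' k
    else fun f u => exists d, reach (letter_of (sem_upto K') K') d f u
  else fun _ _ _ => False.

Definition sem k : F -> seq nat -> Prop := sem_upto k.+1 k.
Definition true_letter k : seq nat -> lett := letter_of sem k.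

Lemma sem_uptoE K k : k < K -> sem_upto K k = sem k.
Proof.
elim: K => // K IH; rewrite ltnS leq_eqVlt => /orP[/eqP-> //|kK].
by rewrite /= kK IH.
Qed.

Lemma true_letterE k : letter_of (sem_upto k) k = true_letter k.
Proof.
apply/funext => u; congr pair; apply/setP => x; rewrite !inE.
by case: ltnP => //= xk; rewrite sem_uptoE.
Qed.

Lemma semE k f u : sem k f u <-> exists d, reach (true_letter k) d f u.
Proof. by rewrite /sem /= ltnn true_letterE. Qed.

Lemma sem_unfold k f u : sem k f u <->
  act f (true_letter k u) = setT \/
  exists i, i < arity t u /\ sem k (act f (true_letter k u)) (rcons u i).
Proof.
split=> [/semE[[|d] /= [|]]|[e|[i [ilt /semE[d r]]]]] //; try by left.
- by move=> [i [ilt r]]; right; exists i; split=> //; apply/semE; exists d.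
- by apply/semE; exists 0; left.
by apply/semE; exists d.+1; right; exists i.
Qed.

Lemma mask_letter_true j k u : j <= k -> mask_letter j (true_letter k u) = true_letter j u.
Proof.
move=> jk; congr pair; apply/setP => x; rewrite !inE.
by case: (ltnP x.2.1 j) => xj; rewrite ?andbF // (leq_trans xj jk) andbT.
Qed.

Definition path_word k pi i m : seq lett :=
  [seq true_letter k (pi j) | j <- iota i m].

(** A finite descent to an exit extends to an infinite path since the tree is leafless; conversely
    the descent follows the path for [m] moves. *)
Lemma sem_path k f u : in_dom t u ->
  (sem k f u <-> exists pi i m, [/\ is_tpath t pi, pi i = u &
     acts f (path_word k pi i m.+1) = setT]).
Proof.
move=> D; split=> [/semE[d]|[pi [i [m [tp <- {u D}]]]]].
  elim: d f u D => [|d IH] f u D /= [e|] //.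
  - by have [pi [tp piu]] := tpath_through D; exists pi, (size u), 0; rewrite /path_word /= piu.
  - by have [pi [tp piu]] := tpath_through D; exists pi, (size u), 0; rewrite /path_word /= piu.
  move=> [i [ilt r]].
  have [|pi [j [m [tp pij e]]]] := IH _ _ _ r; first exact/in_dom_rcons.
  have szj : j = (size u).+1 by rewrite -(size_tpath tp j) pij size_rcons.
  have piu : pi (size u) = u.
    have [i' [_]] := tp.2 (size u); rewrite -szj pij => /eqP.
    by rewrite eqseq_rcons => /andP[/eqP].
  by exists pi, (size u), m.+1; split=> //; rewrite /path_word /= piu -szj.
elim: m i f => [|m IH] i f e; apply/sem_unfold; first by left.
right; have [j [jlt pij]] := tp.2 i.
by exists j; split=> //; rewrite -pij; apply: IH.
Qed.


Hypothesis PF_supported : forall p, p \in PF -> supported_p PF N p.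

Definition sem_init_spec p := forall u, in_dom t u ->
  sem (prank p) (init PF p) u <-> ssat t (SE p) u.

(** * The inductive step on the rank *)

Section FixedRank.
Variable k : nat.
Hypothesis k_le_M : k <= M.
Hypothesis spec_below : forall p, p \in PF -> prank p < k -> sem_init_spec p.

Lemma mem_true_letter n j f u : n <= N -> j < k ->
  ((inord n, (inord j, f)) \in (true_letter k u).2) = (n <= count_children t (sem j f) u).
Proof.
move=> nN jk; rewrite inE /= !inordK ?ltnS ?jk //.
exact: leq_trans (ltnW jk) k_le_M.
Qed.

Lemma ssat_SE_PState g u : in_dom t u -> ssat t (SE (PState g)) u <-> ssat t g u.
Proof.
move=> D; split=> [[pi [i [_ <-]]] //|gu].
by have [pi [tp piu]] := tpath_through D; exists pi, (size u); rewrite /= piu.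
Qed.

Hypothesis N_gt0 : 0 < N.

(** Negation is harmless here: one letter decides a state formula exactly, because the atoms it
    reads have rank below [k], where [spec_below] applies. *)
Lemma seval_true_letter g u : supported_s PF N g -> srank g <= k -> in_dom t u ->
  seval (true_letter k u) g <-> ssat t g u.
Proof.
move=> + + D; elim: g => [x|g IH|g IHg h IHh|n g _|p] //=.
- by move=> sg gk; have {}IH := IH sg gk; split=> [/negP|] ng; [|apply/negP] => /IH.
- move=> /andP[sg sh]; rewrite geq_max => /andP[gk hk].
  have {}IHg := IHg sg gk; have {}IHh := IHh sh hk.
  by split=> [/orP[/IHg|/IHh]|[/IHg|/IHh] ->]; rewrite ?orbT //; [left | right].
- move=> /and3P[nN gPF sg] gk; rewrite mem_true_letter //.
  rewrite (@eq_count_children _ _ _ (ssat t g)); first by split=> /count_childrenP.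
  move=> i ilt; have Di : in_dom t (rcons u i) by apply/in_dom_rcons.
  by apply: iff_trans (ssat_SE_PState g Di); apply: spec_below.
move=> sp pk; have pPF := supported_p_mem sp.
rewrite mask_letter_true ?(ltnW pk) // -act_init // mem_true_letter //.
apply: iff_trans (spec_below pPF pk D); apply: iff_trans (iff_sym (sem_unfold _ _ _)).
split=> [/orP[/eqP->|/count_childrenP[[|i s] [_ // _ sP]]]|[->|[i [ilt si]]]]; first by left.
- by right; exists i; apply: sP; rewrite mem_head.
- by rewrite eqxx.
apply/orP; right; apply/count_childrenP; exists [:: i]; split=> // j.
by rewrite inE => /eqP->.
Qed.

(** The expansion laws of X and U. Only rank at most [k] is claimed, since the letter knows only
    atoms of rank below [k]. *)
Lemma peval_true_letter pi p i (v : pval PF) :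
  is_tpath t pi -> p \in PF -> prank p <= k ->
  (forall q, q \in PF -> prank q <= k -> look v q = `[< psat t q pi i.+1 >]) ->
  peval (true_letter k (pi i)) v p = `[< psat t p pi i >].
Proof.
move=> tp /PF_supported sp pk vP.
elim: p sp pk => [g|p IHp q IHq|p IHp q IHq|p IHp|p IHp q IHq] sp;
  have := supported_p_mem sp; move: sp => /= /andP[_].
- move=> sg _ gk; apply/idP/asboolP => /=;
  by move/(seval_true_letter sg gk (@in_dom_tpath _ _ _ tp i)).
- move=> /andP[sp sq] _; rewrite geq_max => /andP[pk qk].
  by rewrite IHp // IHq // -asbool_and.
- move=> /andP[sp sq] _; rewrite geq_max => /andP[pk qk].
  by rewrite IHp // IHq // -asbool_or.
- by move=> sp _ pk; apply: vP => //; exact: supported_p_mem sp.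
move=> /andP[sp sq] uPF; rewrite geq_max => /andP[pk qk].
rewrite IHp // IHq // vP //=; last by rewrite geq_max pk.
rewrite -asbool_and -asbool_or; apply: asbool_equiv_eq; split=> /=.
  case=> [qi|[pi_ [m [im qm pm]]]].
    by exists i; split=> // j /andP[ij ji]; move: (leq_ltn_trans ij ji); rewrite ltnn.
  exists m; split=> [|//|j /andP[]]; first exact: ltnW.
  by rewrite leq_eqVlt => /orP[/eqP<- //|ij jm]; apply: pm; rewrite ij.
case=> m [im qm pm]; move: im; rewrite leq_eqVlt => /orP[/eqP im|im]; first by left; rewrite im.
right; split; first by apply: pm; rewrite leqnn.
by exists m; split=> // j /andP[ij jm]; apply: pm; rewrite jm ltnW.
Qed.

(** Each state formula is decided by its own letter, and the path operators are monotone and need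
    finitely many positions, so the valuation [v] assumed at the far end no longer matters. *)
Lemma path_cosafe pi p i :
  is_tpath t pi -> p \in PF -> prank p <= k -> psat t p pi i ->
  exists m, forall n, m <= n -> forall v, look (upds (path_word k pi i n) v) p.
Proof.
move=> tp /PF_supported sp.
elim: p i sp => [g|p IHp q IHq|p IHp q IHq|p IHp|p IHp q IHq] i sp;
  have pPF := supported_p_mem sp; move: sp => /= /andP[_].
- move=> sg gk gi; exists 1 => -[//|n] _ v; rewrite look_upd //=.
  exact/(seval_true_letter sg gk (@in_dom_tpath _ _ _ tp i)).
- move=> /andP[sp sq]; rewrite geq_max => /andP[pk qk] [pi_ qi].
  have [m1 P1] := IHp _ sp pk pi_; have [m2 P2] := IHq _ sq qk qi.
  exists (maxn 1 (maxn m1 m2)) => n; rewrite !geq_max => /and3P[n0 n1 n2] v.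
  have := P1 n n1 v; have := P2 n n2 v; case: n n0 {n1 n2} => // n _.
  by rewrite !look_upd ?(supported_p_mem sp) ?(supported_p_mem sq) //= => -> ->.
- move=> /andP[sp sq]; rewrite geq_max => /andP[pk qk] [pi_|qi].
    have [m1 P1] := IHp _ sp pk pi_; exists m1.+1 => -[//|n] n1 v.
    by have := P1 n.+1 (ltnW n1) v; rewrite !look_upd ?(supported_p_mem sp) //= => ->.
  have [m1 P1] := IHq _ sq qk qi; exists m1.+1 => -[//|n] n1 v.
  by have := P1 n.+1 (ltnW n1) v; rewrite !look_upd ?(supported_p_mem sq) //= => ->; rewrite orbT.
- move=> sp pk pi_; have [m P] := IHp _ sp pk pi_.
  exists m.+1 => -[//|n] mn v; rewrite look_upd //=; exact: P.
move=> /andP[sp sq]; rewrite geq_max => /andP[pk qk] [e [ie qe pe]].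
have [m2 P2] := IHq _ sq qk qe.
have look_U n j v : look (upds (path_word k pi j n.+1) v) (PU p q) =
    look (upds (path_word k pi j n.+1) v) q ||
    look (upds (path_word k pi j n.+1) v) p && look (upds (path_word k pi j.+1 n) v) (PU p q).
  by rewrite !look_upd ?(supported_p_mem sp) ?(supported_p_mem sq).
(* Induction on the distance from [i] to the position [e] where [q] holds. *)
move: (e - i) (subnK ie) => d; elim: d i pe {ie} => [|d IH] i pe.
  rewrite add0n => ->; exists m2.+1 => -[//|n] mn v.
  by rewrite look_U P2 // ltnW.
rewrite addSnnS => de.
have lt_ie : i < e by rewrite -de leq_addl.
have [m1 P1] := IHp i sp pk (pe i (introT andP (conj (leqnn i) lt_ie))).
have [|m P] := IH i.+1 _ de.
  by move=> j /andP[ij je]; apply: pe; rewrite je ltnW.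
exists (maxn m1 m.+1) => -[|n]; rewrite geq_max ?andbF // => /andP[n1 n2] v.
by rewrite look_U P1 // P // orbT.
Qed.

Lemma sem_initP p : p \in PF -> prank p = k -> sem_init_spec p.
Proof.
move=> pPF pk u D; rewrite pk.
split=> [/(sem_path _ _ D)[pi [i [m [tp piu e]]]]|[pi [i [tp piu ps]]]].
  exists pi, i; split=> //.
  (* The actual truth values at the end of the word lie in [setT]; [agree] carries them back to
     position [i]. *)
  pose v j : pval PF := [set x | `[< psat t (ssval x) pi j >]].
  have agree n j q : q \in PF -> prank q <= k ->
      look (upds (path_word k pi j n) (v (j + n))) q = `[< psat t q pi j >].
    elim: n j q => [|n IH] j q qPF qk.
      by rewrite addn0 -[q]/(ssval (SeqSub qPF)) lookE inE.
    rewrite look_upd //; apply: peval_true_letter => // r rPF rk.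
    by rewrite -addSnnS; apply: IH.
  apply/asboolP; rewrite -(agree m.+1) ?pk //.
  have : v (i + m.+1) \in acts (init PF p) (path_word k pi i m.+1) by rewrite e inE.
  by rewrite actsE !inE.
(* Conversely, a formula forced whatever the final valuation is exactly the exit condition. *)
apply/sem_path => //; have [|m mP] := path_cosafe tp pPF _ ps; first by rewrite pk.
by exists pi, i, m; split=> //; apply/setP => v; rewrite actsE !inE mP.
Qed.

End FixedRank.

Lemma sem_initE p : 0 < N -> p \in PF -> prank p <= M -> sem_init_spec p.
Proof.
move=> N0; move: {2}(prank p) (erefl (prank p)) => k.
elim/ltn_ind: k p => k IH p pk pPF pM.
apply: (@sem_initP k) => //; first by rewrite -pk.
by move=> q qPF qk; apply: (IH _ qk) => //; apply: leq_trans (ltnW qk) _; rewrite -pk.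
Qed.

End Semantics.

(** * Accepting runs from ranked strategies, and infinite branches of runs *)

Lemma lex_wf (m d : nat -> nat) n0 :
  ~ (forall n, n0 <= n -> m n.+1 < m n \/ m n.+1 = m n /\ d n.+1 < d n).
Proof.
move=> dec.
suff H M D n : n0 <= n -> m n = M -> d n = D -> False by apply: (H _ _ n0).
elim/ltn_ind: M D n => M IHM; elim/ltn_ind => D IHD n nn mn dn.
case: (dec n nn) => [|[]]; rewrite mn ?dn => h.
  by apply: (IHM _ h _ n.+1) => //; apply: leqW.
by move=> h'; apply: (IHD _ h' n.+1) => //; apply: leqW.
Qed.

Section RunConstruction.
Variables (AP Q : finType) (B : ata AP Q) (t : tree AP).
Variables (G : nat -> Q -> seq nat -> Prop) (mu : Q -> nat).

(** A move from a non-accepting state lowers [(mu, d)] lexicographically, so no infinite branch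
    avoids [accF B] from some point on. *)
Definition progress (d : nat) (q : Q) (d' : nat) (q' : Q) : Prop :=
  q \in accF B \/ mu q' < mu q \/ mu q' = mu q /\ d' < d.

Hypothesis G_dom : forall d q u, G d q u -> in_dom t u.
Hypothesis G_step : forall d q u, G d q u ->
  pbf_sat (atom_sem t (fun q' u' => exists d', G d' q' u' /\ progress d q d' q') u)
    (delta B q (label t u)).

Let node := (nat * Q * seq nat)%type.

(** An address [j] codes a counter, a state and a direction. Together with [good] this puts all
    legal moves into the run at once, so that no moves have to be chosen. *)
Let child (n : node) (j : nat) : node :=
  if unpickle j is Some (d, q, i) then (d, q, rcons n.2 i) else n.

Let node_at (n0 : node) (x : seq nat) : node := foldl child n0 x.

Let node_at_rcons n0 x j : node_at n0 (rcons x j) = child (node_at n0 x) j.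
Proof. exact: foldl_rcons. Qed.

Let good n0 x : Prop := forall k, k < size x ->
  let n := node_at n0 (take k x) in let n' := node_at n0 (take k.+1 x) in
  G n'.1.1 n'.1.2 n'.2 /\ progress n.1.1 n.1.2 n'.1.1 n'.1.2.

Let good_rcons n0 x j : good n0 (rcons x j) <->
  good n0 x /\ (let n := node_at n0 x in let n' := child n j in
    G n'.1.1 n'.1.2 n'.2 /\ progress n.1.1 n.1.2 n'.1.1 n'.1.2).
Proof.
have E k : k <= size x -> take k (rcons x j) = take k x.
  by move=> kx; rewrite -cats1 takel_cat.
split=> [g|[g gj] k].
  split=> [k kx|].
    by have := g k; rewrite size_rcons ltnS !E // ltnW // => /(_ isT).
  have := g (size x); rewrite size_rcons ltnSn E // take_size.
  by rewrite take_oversize ?size_rcons // node_at_rcons => /(_ isT).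
rewrite size_rcons ltnS leq_eqVlt => /orP[/eqP->|kx].
  by rewrite E // take_size take_oversize ?size_rcons // node_at_rcons.
by rewrite !E // ?(ltnW kx) //; apply: g.
Qed.

Lemma run_of_strategy d0 q0 u0 : qI B = q0 -> G d0 q0 u0 ->
  exists r, is_run_from B t u0 r /\ accepting B r.
Proof.
move=> qI0 G0; pose n0 : node := (d0, q0, u0).
pose r := Run (good n0) (fun x => ((node_at n0 x).1.2, (node_at n0 x).2)); exists r.
have goodG x : good n0 x -> let n := node_at n0 x in G n.1.1 n.1.2 n.2.
  by case/lastP: x => [|x j] //; case/good_rcons => _ []; rewrite -node_at_rcons.
split.
  split=> //=; first by move=> x j /good_rcons[].
  - by rewrite qI0.
  move=> x gx; have Gx := goodG x gx; split; first exact: G_dom Gx.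
  apply: pbf_sat_mono (G_step Gx) => a.
  apply: (@atom_sem_mono _ t _ _ (fun q' w => has_child_lab r x (q', w))) => i _ [d' [Gd pr]].
  exists (pickle (d', a.2, i)); split=> /=.
    by apply/good_rcons; split=> //; rewrite /child pickleK.
  by rewrite node_at_rcons /child pickleK.
move=> rho rho0 rhoS n1 /=; apply: contrapT => /forallNP nF.
apply: (@lex_wf (fun n => mu (node_at n0 (rho n)).1.2) (fun n => (node_at n0 (rho n)).1.1) n1).
move=> n n1n; have [gS [j eS]] := rhoS n.
move: gS; rewrite eS => /good_rcons[_ [_]]; rewrite -node_at_rcons.
by case=> // inF; case: (nF n).
Qed.

End RunConstruction.

(** Acceptance is applied to the branch that follows the address [x] from the root and then the
    successors given by [g]. *)
Lemma accepting_from (AP Q : finType) (B : ata AP Q) (r : run Q) x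
    (g : seq nat -> nat) (P : seq nat -> Prop) :
  (forall y j, rdom r (rcons y j) -> rdom r y) -> accepting B r ->
  P x -> (forall y, P y -> rdom r y) -> (forall y, P y -> P (rcons y (g y))) ->
  exists y, P y /\ (rlab r y).1 \in accF B.
Proof.
move=> pc acc Px Pdom Pstep.
pose it n := iter n (fun y => rcons y (g y)) x.
have Pit n : P (it n) by elim: n => // n; apply: Pstep.
pose rho n := if n <= size x then take n x else it (n - size x).
have dom_take k : rdom r (take k x).
  have := Pdom _ Px; rewrite -{1}(cat_take_drop k x).
  elim/last_ind: (drop k x) => [|s j IH]; first by rewrite cats0.
  by rewrite -rcons_cat => /pc.
have [||n [xn nF]] := acc rho _ _ (size x).
- by rewrite /rho take0.
- move=> n; rewrite /rho; case: ltnP => nx.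
    by rewrite (ltnW nx); split=> //; exists (nth 0 x n); rewrite (take_nth 0).
  rewrite subSn //; split; first exact/Pdom/Pit.
  exists (g (it (n - size x))); move: nx; rewrite leq_eqVlt => /orP[/eqP<-|nx].
    by rewrite leqnn take_size subnn.
  by rewrite leqNgt nx.
exists (it (n - size x)); split=> //; move: nF; rewrite /rho.
move: xn; rewrite leq_eqVlt => /orP[/eqP<-|xn].
  by rewrite leqnn take_size subnn.
by rewrite leqNgt xn.
Qed.

(** * The hesitant automaton and the transitions of its linearisations *)

Section HTA.
Variables (AP : finType) (PF : seq (pform AP)) (N M : nat).
Notation F := (pred_pval PF).
Notation base := (base PF N M).
Notation lett := (lett PF N M).
Notation Q := (bool * ('I_M.+1 * F))%type.
Implicit Types (q : Q) (f : F) (x : base) (s : bool) (b : {set base}).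

Definition pos_atom x : atom Q := (Dia x.1, (true, x.2)).
(** [Box n] tolerates fewer than [n] exceptions, so this literal says that fewer than [n] children
    satisfy the positive state. *)
Definition neg_atom x : atom Q := (Box x.1, (false, x.2)).

(* [s = false] gives the dual clause, with every literal of [b] negated. *)
Definition lit s b x : atom Q := if (x \in b) == s then pos_atom x else neg_atom x.
Definition lits s (k : 'I_M.+1) b : seq (atom Q) :=
  [seq lit s b x | x <- enum (below PF N M k)].

(** Reaching [setT] is the exit, so the clause then contains no move. *)
Definition stay s (k : 'I_M.+1) f : seq (atom Q) :=
  if f == setT then [::] else [:: (if s then Dia 1 else Box 1, (s, (k, f)))].

Definition clauses q (sigma : {set AP}) : seq (seq (atom Q)) :=
  let: (s, (k, f)) := q in
  [seq lits s k b ++ stay s k (act f (sigma, b))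
     | b <- enum (powerset (below PF N M k))].

Definition hta_delta q sigma : pbf (atom Q) :=
  if q.1 then dnf_pbf (clauses q sigma) else cnf_pbf (clauses q sigma).

Definition hta q0 : ata AP Q :=
  {| delta := hta_delta; qI := q0; accF := [set q : Q | ~~ q.1] |}.

(** One component per rank [k] and sign, numbered [2 k] if positive and [2 k + 1] if negative; both
    signs of a lower rank lie strictly below, so literals of either polarity are allowed. *)
Definition hta_part : hpart Q :=
  HPart (fun q : Q => (q.2.1 : nat).*2 + ~~ q.1)
        (fun i => if odd i then Universal else Existential).

Notation comp := (Defs.comp hta_part).
Notation kind := (kind hta_part).

Lemma kind_comp q : kind (comp q) = if q.1 then Existential else Universal.
Proof. by rewrite /= oddD odd_double /=; case: q.1. Qed.

Lemma comp_inj q q' : comp q = comp q' -> q.1 = q'.1 /\ q.2.1 = q'.2.1.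
Proof.
move=> /= e; have := congr1 odd e; rewrite !oddD !odd_double /= => es.
have {es} es : q.1 = q'.1 by case: q.1 q'.1 es => [] [].
split=> //; move: e; rewrite es => /addIn /double_inj; exact: val_inj.
Qed.

Lemma lits_below s k b a q : a \in lits s k b -> q.2.1 = k -> comp a.2 < comp q.
Proof.
case/mapP => x; rewrite mem_enum inE => xk -> qk /=.
have -> : (lit s b x).2.2 = x.2 by rewrite /lit; case: ifP.
rewrite qk; apply: (@leq_trans (x.2.1 : nat).+1.*2); last first.
  by apply: leq_trans (leq_addr _ _); rewrite leq_double.
by rewrite doubleS !ltnS; case: (~~ _); rewrite ?addn0 ?addn1.
Qed.

Lemma clauseP q sigma c : c \in clauses q sigma ->
  exists2 b : {set base}, b \subset below PF N M q.2.1 &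
    c = lits q.1 q.2.1 b ++ stay q.1 q.2.1 (act q.2.2 (sigma, b)).
Proof.
case: q => s [k f] /mapP[b]; rewrite mem_enum powersetE => bk ->.
by exists b.
Qed.

Lemma inside_lits q b : filter (inside hta_part (comp q)) (lits q.1 q.2.1 b) = [::].
Proof.
rewrite -(filter_pred0 (lits q.1 q.2.1 b)); apply: eq_in_filter => a al.
by rewrite /inside ltn_eqF ?(lits_below al).
Qed.

Lemma outside_lits q b :
  filter (fun a => ~~ inside hta_part (comp q) a) (lits q.1 q.2.1 b) = lits q.1 q.2.1 b.
Proof.
rewrite -[RHS]filter_predT; apply: eq_in_filter => a al.
by rewrite /inside ltn_eqF ?(lits_below al).
Qed.

Lemma inside_stay q f : all (inside hta_part (comp q)) (stay q.1 q.2.1 f).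
Proof. by rewrite /stay; case: eqP => //= _; rewrite /inside /= eqxx. Qed.

Lemma inside_clause q b f :
  filter (inside hta_part (comp q)) (lits q.1 q.2.1 b ++ stay q.1 q.2.1 f) = stay q.1 q.2.1 f.
Proof. by rewrite filter_cat inside_lits; apply/all_filterP/inside_stay. Qed.

Lemma outside_clause q b f :
  filter (fun a => ~~ inside hta_part (comp q) a) (lits q.1 q.2.1 b ++ stay q.1 q.2.1 f)
  = lits q.1 q.2.1 b.
Proof.
rewrite filter_cat outside_lits -[RHS]cats0; congr cat.
apply/eqP; rewrite -[_ == _]negbK -has_filter -all_predC.
by apply: sub_all (inside_stay q f) => a /= ->.
Qed.

Lemma hta_hesitant q0 : hesitant (hta q0) hta_part.
Proof.
move=> q sigma i f0.
have atomsP a : a \in pbf_atoms f0 -> exists2 c, c \in clauses q sigma & a \in c.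
  have -> : pbf_atoms f0 = flatten (clauses q sigma).
    by rewrite /f0 /= /hta_delta; case: q.1; rewrite (atoms_dnf_pbf, atoms_cnf_pbf).
  by move/flattenP.
have insideP a : a \in pbf_atoms f0 -> inside hta_part i a ->
    a.1 = if q.1 then Dia 1 else Box 1.
  case/atomsP => c /clauseP[b _ ->] ac ia.
  have : a \in filter (inside hta_part i)
      (lits q.1 q.2.1 b ++ stay q.1 q.2.1 (act q.2.2 (sigma, b))).
    by rewrite mem_filter ia.
  by rewrite inside_clause /stay; case: eqP => // _; rewrite inE => /eqP->.
have sizeP c : c \in clauses q sigma -> size (undup (filter (inside hta_part i) c)) <= 1.
  case/clauseP => b _ ->; rewrite inside_clause; apply: leq_trans (size_undup _) _.
  by rewrite /stay; case: eqP.
split.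
  move=> a /atomsP[c /clauseP[b _ ->]]; rewrite mem_cat => /orP[al|ast].
    exact/ltnW/(lits_below al).
  by have /allP/(_ _ ast)/eqP-> := inside_stay q (act q.2.2 (sigma, b)).
rewrite [kind i]kind_comp; move: insideP sizeP; rewrite /f0 /= /hta_delta.
by case: q.1 => insP szP; split=> //; rewrite ?dnf_dnf_pbf ?cnf_cnf_pbf.
Qed.

Lemma hta_polarised q0 : polarised (hta q0) hta_part.
Proof. by move=> q; rewrite kind_comp inE; case: q.1. Qed.

(* The assignment is read off an annotation by looking at the literals that
   [lits] puts there exactly when [x \in b]. *)
Definition decode s (k : 'I_M.+1) (l : letter AP Q) : lett :=
  (l.1, [set x in below PF N M k | lit s setT x \in l.2]).

Lemma lit_inj s b x y : lit s b x = lit s setT y -> x \in b /\ x = y.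
Proof.
rewrite /lit inE /pos_atom /neg_atom; case: x y => [n p] [n' p'] /=.
by case: (_ \in b) s => [] [] //= [] // /val_inj-> ->.
Qed.

Lemma decodeE s (k : 'I_M.+1) b (sigma : {set AP}) (C : seq (atom Q)) :
  b \subset below PF N M k -> lits s k b =i C ->
  decode s k (sigma, C) = (sigma, b).
Proof.
move=> bk CE; congr pair; apply/setP => x; rewrite inE -CE.
apply/andP/idP => [[xk /mapP[y _ /esym/lit_inj[yb yx]]]|xb]; first by rewrite -yx.
have xk := subsetP bk x xb; split=> //; apply/mapP; exists x; first by rewrite mem_enum.
by rewrite /lit xb inE.
Qed.

(** The annotation determines the assignment [b], hence there is at most one successor within the
    component. *)
Lemma lin_transP q0 q i sigma C p' :
  comp q = i -> lin_trans (hta q0) hta_part i (Some q) (sigma, C) p' ->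
  exists b : {set base}, [/\ b \subset below PF N M q.2.1, lits q.1 q.2.1 b =i C &
    if p' is Some q' then q' = (q.1, (q.2.1, act q.2.2 (sigma, b))) else True].
Proof.
move=> <- [_]; rewrite kind_comp.
have nfE : (if (if q.1 then Existential else Universal) is Existential
    then dnf (hta_delta q sigma) else cnf (hta_delta q sigma)) = clauses q sigma.
  by rewrite /hta_delta; case: q.1; rewrite (dnf_dnf_pbf, cnf_cnf_pbf).
have main c q' : c \in clauses q sigma ->
    filter (inside hta_part (comp q)) c =i [:: (if q.1 then Dia 1 else Box 1, q')] ->
    filter (fun a => ~~ inside hta_part (comp q) a) c =i C ->
  exists b : {set base}, [/\ b \subset below PF N M q.2.1, lits q.1 q.2.1 b =i C &
    q' = (q.1, (q.2.1, act q.2.2 (sigma, b)))].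
  case/clauseP => b bk ->; rewrite inside_clause outside_clause => iE oE.
  exists b; split=> //; have := iE (if q.1 then Dia 1 else Box 1, q').
  by rewrite mem_head /stay; case: eqP => // _; rewrite inE => /eqP[].
have main' c : c \in clauses q sigma -> all (fun a => ~~ inside hta_part (comp q) a) c ->
    c =i C -> exists b : {set base}, b \subset below PF N M q.2.1 /\ lits q.1 q.2.1 b =i C.
  case/clauseP => b bk -> out; move/all_filterP: out; rewrite outside_clause => <-.
  by exists b.
case: p' => [q'|]; case: q.1 nfE main main' => nfE main main'.
- by case=> _ _ [c []]; rewrite nfE; apply: main.
- by case=> _ _ [c []]; rewrite nfE; apply: main.
- by case=> _ [c]; rewrite nfE => -[h1 [h2 h3]]; have [b [? ?]] := main' _ h1 h2 h3; exists b.
- by case=> _ [c]; rewrite nfE => -[h1 [h2 h3]]; have [b [? ?]] := main' _ h1 h2 h3; exists b.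
Qed.

End HTA.

(** * Counter-freeness *)

Section HTACorrect.
Variables (AP : finType) (PF : seq (pform AP)) (N M : nat).
Notation F := (pred_pval PF).
Notation base := (base PF N M).
Notation Q := (bool * ('I_M.+1 * F))%type.
Notation hta := (@hta AP PF N M).
Notation hta_part := (@hta_part AP PF M).
Notation comp := (Defs.comp hta_part).
Notation kind := (kind hta_part).
Implicit Types (q : Q) (f : F) (x : base) (s : bool) (b : {set base}).

Lemma lin_path_cat (A : ata AP Q) i w1 w2 p p' :
  lin_path A hta_part i p (w1 ++ w2) p' <->
  exists p1, lin_path A hta_part i p w1 p1 /\ lin_path A hta_part i p1 w2 p'.
Proof.
elim: w1 p => [|l w1 IH] p /=; first by split=> [? | [? [-> ]]] //; exists p.
split=> [[p1 [tr /IH[p2 [h1 h2]]]]|[p2 [[p1 [tr h1]] h2]]].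
  by exists p2; split=> //; exists p1.
by exists p1; split=> //; apply/IH; exists p2.
Qed.

Lemma lin_path_exit (A : ata AP Q) i w p' :
  lin_path A hta_part i None w p' -> p' = None.
Proof.
elim: w => [|l w IH] //= [[q|] [[_ tr]] //].
by move: tr => /=; case: (odd i).
Qed.

Lemma lin_pathP q0 i q w q' : comp q = i ->
  lin_path (hta q0) hta_part i (Some q) w (Some q') ->
  q' = (q.1, (q.2.1, acts q.2.2 [seq decode N q.1 q.2.1 l | l <- w])).
Proof.
elim: w q => [|[sigma C] w IH] q qi /=; first by case: q {qi} => s [k f] [<-].
case=> -[q1|] [tr]; last by move/lin_path_exit.
have [b [bk CE ->]] := lin_transP qi tr => /IH-> //=.
by rewrite (decodeE sigma bk CE).
Qed.

Hypothesis PF_supported : forall p, p \in PF -> supported_p PF N p.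

Lemma hta_counter_free q0 : counter_free (hta q0) hta_part.
Proof.
move=> q _ p p_in u [//|n] _ /= /[dup] pth /lin_path_cat[p1 [pth1 pth2]].
case: p p_in pth pth1 pth2 => [q'|] p_in pth pth1 pth2; last first.
  by have e := lin_path_exit pth1; subst p1.
(* The exit state is absorbing, so a path returning to [q'] stays in the component and is computed
   by [acts]. *)
case: p1 pth1 pth2 => [q1|] pth1 pth2; last by have := lin_path_exit pth2.
have e1 := lin_pathP p_in pth1.
have := lin_pathP p_in pth; rewrite -[u ++ _]/(flatten (nseq n.+1 u)) map_flatten map_nseq.
set w := [seq _ | l <- u] => e.
suff e' : acts q'.2.2 w = q'.2.2.
  move: e1; rewrite -/w e' => e1; rewrite {1}e1 in pth1.
  by case: q' pth1 {e e' e1 w p_in pth pth2} => ? [].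
apply: (acts_counter_free PF_supported (ltn0Sn n)).
by rewrite [in RHS]e.
Qed.

(** * The language of the automaton *)

Section OnTree.
Variable t : tree AP.
Notation sem := (sem N M t).
Notation true_letter := (true_letter PF N M t).

Definition state_sem q (u : seq nat) : Prop :=
  if q.1 then sem q.2.1 q.2.2 u else ~ sem q.2.1 q.2.2 u.

Lemma subset_notin (T : finType) (A B : {set T}) y :
  A \subset B -> y \notin B -> (y \in A) = false.
Proof. by move=> /subsetP sAB; apply: contraNF => /sAB. Qed.

Lemma true_letter_below k u : (true_letter k u).2 \subset below PF N M k.
Proof. by apply/subsetP => x; rewrite !inE => /andP[]. Qed.

Lemma pos_atom_sem (k : nat) x u : x \in below PF N M k ->
  atom_sem t state_sem u (pos_atom x) <-> x \in (true_letter k u).2.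
Proof. by rewrite !inE => ->; exact: atom_sem_Dia. Qed.

Lemma neg_atom_sem (k : nat) x u : x \in below PF N M k ->
  atom_sem t state_sem u (neg_atom x) <-> x \notin (true_letter k u).2.
Proof.
rewrite !inE => -> /=; rewrite -ltnNge; apply: iff_trans (atom_sem_Box _ _ _ _ _) _.
rewrite (@eq_count_children _ _ _ (sem x.2.1 x.2.2)) // => i _; split=> [/contrapT|] //.
by move=> h; apply.
Qed.

Lemma lit_sem s b (k : nat) x u : x \in below PF N M k ->
  atom_sem t state_sem u (lit s b x) <-> (x \in (true_letter k u).2) = ((x \in b) == s).
Proof.
move=> xk; rewrite /lit; case: ifP => _.
  by apply: iff_trans (pos_atom_sem _ xk) _; split=> [->|->].
by apply: iff_trans (neg_atom_sem _ xk) _; split=> [/negbTE->|->].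
Qed.

Section Soundness.
Variables (Q' : finType) (B : ata AP Q') (h : Q -> Q') (r : run Q') (u0 : seq nat).
Hypothesis delta_h : forall q sigma,
  delta B (h q) sigma = pbf_map (fun a : atom Q => (a.1, h a.2)) (hta_delta N q sigma).
Hypothesis accF_h : forall q, (h q \in accF B) = ~~ q.1.
Hypothesis run_r : is_run_from B t u0 r.
Hypothesis acc_r : accepting B r.

(** Induction on the rank, with [lower] treating the literals. The embedding [h] covers both [hta]
    itself and its variants with a fresh initial state. *)
Lemma state_sem_run q (x v : seq nat) : rdom r x -> rlab r x = (h q, v) -> state_sem q v.
Proof.
have [_ pc _ rP] := run_r.
move: {2}(q.2.1 : nat) (erefl (q.2.1 : nat)) => k.
elim/ltn_ind: k q x v => k IH.
have lower q (x v : seq nat) (a : atom Q) s b :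
    (q.2.1 : nat) = k -> rdom r x -> (rlab r x).2 = v ->
    a \in lits s q.2.1 b -> atom_holds t r x (a.1, h a.2) -> atom_sem t state_sem v a.
  move=> qk dx <- al; have ak : a.2.2.1 < k.
    case/mapP: al => y; rewrite mem_enum inE -qk => yk ->.
    by rewrite /lit; case: ifP.
  apply: (@atom_sem_mono _ t _ (fun q w => has_child_lab r x (h q, w))) => i _ [j [dj ej]].
  exact: (IH _ ak a.2 _ _ erefl dj ej).
(* The clause satisfied by the run must be that of the true assignment, since its literals hold
   semantically. *)
have pos_step f (x v : seq nat) (k' : 'I_M.+1) :
    (k' : nat) = k -> rdom r x -> rlab r x = (h (true, (k', f)), v) ->
    act f (true_letter k v) = setT \/
    exists i j, [/\ i < arity t v, rdom r (rcons x j) &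
      rlab r (rcons x j) = (h (true, (k', act f (true_letter k v))), rcons v i)].
  move=> k'k dx lx; have [_] := rP x dx.
  rewrite lx delta_h pbf_sat_map => /pbf_sat_dnf[c [/clauseP[b /= bk ->] cP]].
  have bE : (label t v, b) = true_letter k v.
    suff -> : b = (true_letter k v).2 by [].
    rewrite k'k in bk; apply/setP => y.
    case: (boolP (y \in below PF N M k)) => yk; last first.
      by rewrite (subset_notin bk yk) (subset_notin (true_letter_below _ _) yk).
    have yl : lit true b y \in lits true k' b.
      by apply/mapP; exists y; rewrite ?mem_enum ?k'k.
    have /(lit_sem _ _ _ yk) -> : atom_sem t state_sem v (lit true b y);
      last by case: (y \in b).
    apply: (@lower (true, (k', f)) x v _ true b) => //; first by rewrite lx.
    by apply: cP; rewrite mem_cat yl.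
  have {}cP : forall a, a \in stay true k' (act f (true_letter k v)) ->
      atom_holds t r x (a.1, h a.2).
    by move=> a ast; apply: cP; rewrite mem_cat bE ast orbT.
  move: cP; rewrite /stay; case: eqP => [|_] cP; first by left.
  right; have [s1 [_ + sP]] := cP _ (mem_head _ _); case: s1 sP => [|i s1] //= sP _.
  have [ilt [j [dj ej]]] := sP i (mem_head _ _); rewrite lx in ilt ej.
  by exists i, j.
(* All clauses are satisfied; in that of the true assignment every literal is false, so only the
   move remains. *)
have neg_step f (x v : seq nat) (k' : 'I_M.+1) :
    (k' : nat) = k -> rdom r x -> rlab r x = (h (false, (k', f)), v) ->
    act f (true_letter k v) <> setT /\
    forall i, i < arity t v -> exists j, rdom r (rcons x j) /\
      rlab r (rcons x j) = (h (false, (k', act f (true_letter k v))), rcons v i).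
  move=> k'k dx lx; have [_] := rP x dx.
  rewrite lx delta_h pbf_sat_map => /pbf_sat_cnf cP.
  have [|a [+ aP]] := cP (lits false k' (true_letter k v).2 ++
      stay false k' (act f (true_letter k v))).
    by apply/mapP; exists (true_letter k v).2; rewrite // mem_enum powersetE k'k true_letter_below.
  rewrite mem_cat => /orP[al|].
    have := @lower (false, (k', f)) x v a _ _ k'k dx _ al aP; rewrite lx => /(_ erefl).
    case/mapP: al => y; rewrite mem_enum k'k => yk -> /(lit_sem _ _ _ yk).
    by case: (_ \in _).
  rewrite /stay; case: eqP => // nT; rewrite inE => /eqP aE; split=> // i ilt.
  move: aP; rewrite aE => -[[|? ?] [_ //= _ sP]]; rewrite lx in sP.
  exact: sP.
case=> [[] [k' f]] x v /= k'k dx lx; rewrite /state_sem /=.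
  apply: contrapT => nsem.
  (* Falsity of a positive state would propagate along an infinite branch of positive states, none
     of them accepting. *)
  pose bad y := rdom r y /\ exists (f : F) w, rlab r y = (h (true, (k', f)), w) /\ ~ sem k' f w.
  have badS y : exists j, bad y -> bad (rcons y j).
    case: (pselect (bad y)) => [[dy [f1 [w [ly ns]]]]|nb]; last by exists 0.
    have [e|[i [j [ilt dj lj]]]] := pos_step f1 y w k' k'k dy ly.
      by case: ns; apply/sem_unfold; left; rewrite k'k.
    exists j => _; split=> //; exists (act f1 (true_letter k w)), (rcons w i); split=> // s1.
    by case: ns; apply/sem_unfold; right; exists i; rewrite {2}k'k.
  have [g gP] := choice badS.
  have [||| y [[dy [f1 [w [ly _]]]]]] := @accepting_from _ _ B r x g bad pc acc_r.
  - by split=> //; exists f, v.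
  - by move=> y [].
  - exact: gP.
  by rewrite ly accF_h.
(* For a negative state, a supposed descent to an exit can be followed in the run, whose moves cover
   all children, until [neg_step] excludes [setT]. *)
case/semE => d; elim: d f x v dx lx => [|d IHd] f x v dx lx /=;
  have [nT ch] := neg_step f x v k' k'k dx lx; rewrite k'k; first by case.
case=> // -[i [ilt ri]]; have [j [dj lj]] := ch i ilt.
by rewrite -k'k in ri lj; apply: IHd dj lj ri.
Qed.

End Soundness.

(** [d] bounds the moves left to a positive state; it is arbitrary for a negative one, which is
    accepting. *)
Definition strategy d q u : Prop :=
  in_dom t u /\
  if q.1 then reach t (true_letter q.2.1) d q.2.2 u else ~ sem q.2.1 q.2.2 u.

Lemma strategyP q u : in_dom t u -> (state_sem q u <-> exists d, strategy d q u).
Proof.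
move=> D; rewrite /strategy /state_sem; case: q.1; last by split=> [|[d []]] //; exists 0.
by split=> [/semE[d r]|[d [_ r]]]; [exists d | apply/semE; exists d].
Qed.

Lemma strategy_step d q u : strategy d q u ->
  pbf_sat (atom_sem t (fun q' u' => exists d', strategy d' q' u' /\
      (~~ q.1 \/ q'.2.1 < q.2.1 \/ q'.2.1 = q.2.1 :> nat /\ d' < d)) u)
    (hta_delta N q (label t u)).
Proof.
move=> [D]; set P := fun _ _ => _.
have lower s b x : x \in below PF N M q.2.1 ->
    atom_sem t state_sem u (lit s b x) -> atom_sem t P u (lit s b x).
  rewrite inE => xk; apply: atom_sem_mono => i ilt.
  have Di : in_dom t (rcons u i) by apply/in_dom_rcons.
  case/(strategyP _ Di) => d' st; exists d'; split=> //; right; left.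
  by rewrite /lit; case: ifP.
case: q @P lower => [[] [k f]] P lower; rewrite /hta_delta [_.1]/= [_.2.1]/= [_.2.2]/=.
  move=> r; apply/pbf_sat_dnf.
  (* A positive state picks the clause of the true assignment and moves to a child with a smaller
     counter. *)
  exists (lits true k (true_letter k u).2 ++ stay true k (act f (true_letter k u))); split.
    by apply/mapP; exists (true_letter k u).2; rewrite // mem_enum powersetE true_letter_below.
  move=> a; rewrite mem_cat => /orP[/mapP[x]|].
    rewrite mem_enum => xk ->; apply: lower => //; apply/(lit_sem _ _ _ xk).
    by case: (_ \in _).
  rewrite /stay; case: eqP => // nT; rewrite inE => /eqP->.
  case: d @P lower r => [|d] P lower [] // [i [ilt r]].
  exists [:: i]; split=> // j; rewrite inE => /eqP->; split=> //.
  exists d; split; last by right; right; split.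
  by split=> //; apply/in_dom_rcons.
move=> nsem; apply/pbf_sat_cnf => c /clauseP[b /= bk ->].
(* In a dual clause, if [b] is not the true assignment then a literal where they differ holds;
   otherwise the move to all children does. *)
have [e|ne] := pselect ((true_letter k u).2 = b); last first.
  have [x xb] : exists x, (x \in (true_letter k u).2) <> (x \in b).
    by apply/existsNP => e; apply: ne; apply/setP.
  have xk : x \in below PF N M k.
    apply/negPn/negP => xk; apply: xb.
    by rewrite (subset_notin bk xk) (subset_notin (true_letter_below _ _) xk).
  exists (lit false b x); split.
    by rewrite mem_cat; apply/orP; left; apply/mapP; exists x; rewrite ?mem_enum.
  apply: lower => //; apply/(lit_sem _ _ _ xk).
  by case: (_ \in _) (_ \in _) xb => [] [].
have bE : (label t u, b) = true_letter k u by rewrite -e.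
rewrite bE /stay; case: eqP => [eT|nT]; first by case: nsem; apply/sem_unfold; left.
exists (Box 1, (false, (k, act f (true_letter k u)))); rewrite mem_cat mem_head orbT; split=> //.
exists [::]; split=> // i ilt _; exists 0; split; last by left.
split; first exact/in_dom_rcons.
by move=> s1; apply: nsem; apply/sem_unfold; right; exists i.
Qed.

Lemma in_dom_nil : in_dom t [::]. Proof. by []. Qed.

Lemma accepts_hta q0 : accepts (hta q0) t <-> state_sem q0 [::].
Proof.
split=> [[r [run_r acc_r]]|/(strategyP _ in_dom_nil)[d st]].
  have [d0 _ l0 _] := run_r.
  apply: (@state_sem_run _ (hta q0) id r [::] _ _ run_r acc_r q0 [::]) => //= [q sigma|q].
    by rewrite -[LHS]pbf_map_id; congr pbf_map; apply/funext => -[].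
  by rewrite inE.
apply: (@run_of_strategy _ _ (hta q0) t strategy (fun q => q.2.1) _ _ d q0) => //.
  by move=> ? ? ? [].
move=> {d st} d q u /strategy_step; apply: pbf_sat_mono => a.
apply: atom_sem_mono => i _ [d' [st pr]]; exists d'; split=> //.
by rewrite /progress inE.
Qed.

Lemma accepts_with_init q0 th :
  accepts (with_init (hta q0) th) t <-> atom_sem t state_sem [::] th.
Proof.
split=> [[r [run_r acc_r]]|th_sem].
  have [d0 _ l0 rP] := run_r; have [_] := rP _ d0; rewrite l0 /= => ath.
  have {ath}: atom_sem t (fun q w => has_child_lab r [::] (Some q, w)) [::] th.
    by move: ath; rewrite /atom_holds /atom_sem l0 /=; case: th.1.
  apply: atom_sem_mono => i _ [j [dj lj]].
  apply: (@state_sem_run _ (with_init (hta q0) th) Some r [::] _ _ run_r acc_r _ _ _ dj lj) => // q.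
  by rewrite mem_imset ?inE //; apply: Some_inj.
pose G d (q : option Q) u := if q is Some q then strategy d q u else u = [::].
(* [M.+1] exceeds every rank, so leaving the fresh initial state is progress. *)
pose mu (q : option Q) : nat := if q is Some q then q.2.1 else M.+1.
apply: (@run_of_strategy _ _ (with_init (hta q0) th) t G mu _ _ 0 None) => //.
  by move=> d [q|] u => [[]|->].
move=> d [q|] u /=.
  move/strategy_step; rewrite pbf_sat_map; apply: pbf_sat_mono => a.
  apply: (@atom_sem_mono _ t _ _ (fun q' u' => exists d',
    G d' (Some q') u' /\ progress (with_init (hta q0) th) mu d (Some q) d' (Some q'))).
  move=> i _ [d' [st pr]]; exists d'; split=> //.
  by rewrite /progress mem_imset ?inE //; apply: Some_inj.
move=> ->; apply: (@atom_sem_mono _ t _ state_sem (fun q' u' => exists d',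
  G d' (Some q') u' /\ progress (with_init (hta q0) th) mu d None d' (Some q')) _ th) th_sem.
move=> i ilt; have Di : in_dom t (rcons [::] i) by apply/in_dom_rcons.
by case/(strategyP _ Di) => d' st; exists d'; split=> //; right; left; rewrite /= ltn_ord.
Qed.

End OnTree.

(** * Visibility *)

Lemma pos_neg_complementary q0 x :
  complementary (with_init (hta q0) (pos_atom x)) (with_init (hta q0) (neg_atom x)).
Proof.
(* Ranks are at most [M], so the letter of rank [M.+1] decides every base atom. *)
move=> t; have xM : x \in below PF N M M.+1 by rewrite inE ltn_ord.
apply: iff_trans (accepts_with_init _ _ _) _; apply: iff_trans (pos_atom_sem _ _ xM) _.
split=> [xt /accepts_with_init/(neg_atom_sem _ _ xM)/negP //|nacc].
by apply: contrapT => /negP/(neg_atom_sem _ _ xM)/accepts_with_init.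
Qed.

Lemma annotationP q0 q C : annotation (hta q0) hta_part (comp q) C ->
  exists b : {set base}, b \subset below PF N M q.2.1 /\ lits q.1 q.2.1 b =i C.
Proof.
case=> q' [sigma [p [e tr]]]; have [b [bk CE _]] := lin_transP e tr.
by have [<- <-] := comp_inj e; exists b.
Qed.

Lemma hta_visible q0 : visible (hta q0) hta_part.
Proof.
move=> q _ C C' /annotationP[b [bk CE]] /annotationP[b' [bk' CE']] CC'.
have [x xb] : exists x, (x \in b) <> (x \in b').
  apply/existsNP => e; apply: CC' => a; rewrite -CE -CE'.
  by have /setP -> : b =i b'.
have xk : x \in below PF N M q.2.1.
  apply/negPn/negP => xk; apply: xb; by rewrite !(subset_notin _ xk).
have pn := pos_neg_complementary q0 x.
have np : complementary (with_init (hta q0) (neg_atom x)) (with_init (hta q0) (pos_atom x)).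
  by move=> t; have := pn t => -[h1 h2]; split=> [a1 /h1|] //; move=> na; apply: contrapT => /h2.
have mem b1 : lit q.1 b1 x \in lits q.1 q.2.1 b1.
  by apply/mapP; exists x; rewrite ?mem_enum.
(* The assignments disagree at [x], so these are [pos_atom x] and [neg_atom x] in some order. *)
exists (lit q.1 b x), (lit q.1 b' x); rewrite -CE -CE'; split=> //.
by rewrite /lit; case: (x \in b) (x \in b') q.1 xb => [] [] [].
Qed.

End HTACorrect.

(** * Subformulae and grades of a formula *)

Section Closure.
Variable AP : finType.

Fixpoint max_grade_s (g : sform AP) : nat :=
  match g with
  | SAtom _ => 0
  | SNot g => max_grade_s g
  | SOr g h => maxn (max_grade_s g) (max_grade_s h)
  | SD n g => maxn n (max_grade_s g)
  | SE p => max_grade_p p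
  end
with max_grade_p (p : pform AP) : nat :=
  match p with
  | PState g => max_grade_s g
  | PX p => max_grade_p p
  | PConj p q | PDisj p q | PU p q => maxn (max_grade_p p) (max_grade_p q)
  end.

Fixpoint subs_s (g : sform AP) : seq (pform AP) :=
  match g with
  | SAtom _ => [::]
  | SNot g => subs_s g
  | SOr g h => subs_s g ++ subs_s h
  | SD n g => PState g :: subs_s g
  | SE p => subs_p p
  end
with subs_p (p : pform AP) : seq (pform AP) :=
  p :: match p with
  | PState g => subs_s g
  | PX p => subs_p p
  | PConj p q | PDisj p q | PU p q => subs_p p ++ subs_p q
  end.

Lemma supported_subs PF N :
  (forall g, {subset subs_s g <= PF} -> max_grade_s g <= N -> supported_s PF N g) /\
  (forall p, {subset subs_p p <= PF} -> max_grade_p p <= N -> supported_p PF N p).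
Proof.
have sub_l (s1 s2 : seq (pform AP)) : {subset s1 ++ s2 <= PF} -> {subset s1 <= PF}.
  by move=> sub x xs; apply: sub; rewrite mem_cat xs.
have sub_r (s1 s2 : seq (pform AP)) : {subset s1 ++ s2 <= PF} -> {subset s2 <= PF}.
  by move=> sub x xs; apply: sub; rewrite mem_cat xs orbT.
have sub_c x (s1 : seq (pform AP)) : {subset x :: s1 <= PF} -> x \in PF /\ {subset s1 <= PF}.
  by move=> sub; split=> [|y ys]; apply: sub; rewrite inE ?eqxx ?ys ?orbT.
by apply: sform_pform_ind => //= [g IHg h IHh sub|n g IH /sub_c[gPF sub]|g IH /sub_c[gPF sub]|
    p IHp q IHq /sub_c[gPF sub]|p IHp q IHq /sub_c[gPF sub]|p IH /sub_c[gPF sub]|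
    p IHp q IHq /sub_c[gPF sub]];
  rewrite ?geq_max => gr; rewrite ?gPF /=; try case/andP: gr => g1 g2; rewrite ?g1 /= ?IH //;
  apply/andP; split; eauto.
Qed.

(** With [supported_subs], this makes the list of subformulae of one formula satisfy
    [PF_supported]. *)
Lemma subs_supported PF N :
  (forall g, supported_s PF N g -> forall q, q \in subs_s g -> supported_p PF N q) /\
  (forall p, supported_p PF N p -> forall q, q \in subs_p p -> supported_p PF N q).
Proof.
apply: sform_pform_ind => //=.
- by move=> g IHg h IHh /andP[sg sh] q; rewrite mem_cat => /orP[/IHg|/IHh]; apply.
- move=> n g IH /and3P[_ gPF sg] q; rewrite inE => /orP[/eqP->|/IH]; last exact.
  by rewrite /= gPF.
- by move=> g IH sup q; rewrite inE => /orP[/eqP-> //|/IH]; apply; case/andP: sup.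
- move=> p IHp r IHr sup q; rewrite inE => /orP[/eqP-> //|].
  by case/and3P: sup => _ sp sr; rewrite mem_cat => /orP[/IHp|/IHr]; apply.
- move=> p IHp r IHr sup q; rewrite inE => /orP[/eqP-> //|].
  by case/and3P: sup => _ sp sr; rewrite mem_cat => /orP[/IHp|/IHr]; apply.
- by move=> p IH sup q; rewrite inE => /orP[/eqP-> //|/IH]; apply; case/andP: sup.
move=> p IHp r IHr sup q; rewrite inE => /orP[/eqP-> //|].
by case/and3P: sup => _ sp sr; rewrite mem_cat => /orP[/IHp|/IHr]; apply.
Qed.

End Closure.

Theorem theorem7p5 (AP : finType) (phi : sform AP) :
  exists (Q : finType) (A : ata AP Q) (H : hpart Q),
    [/\ hesitant A H, polarised A H, counter_free A H, visible A H &
        forall t : tree AP, lang_formula phi t <-> accepts A t].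
Proof.
pose p0 := PState phi; pose PF := subs_p p0.
(* Grade 1 must be available even without [SD], since [SE] is evaluated through an atom of grade
   1. *)
pose N := maxn 1 (max_grade_p p0); pose M := prank p0.
have sup0 : supported_p PF N p0.
  by apply: (supported_subs PF N).2 => //; rewrite leq_maxr.
have sup p : p \in PF -> supported_p PF N p by apply: (subs_supported PF N).2.
pose q0 : (bool * ('I_M.+1 * pred_pval PF))%type := (true, (ord_max, init PF p0)).
exists (bool * ('I_M.+1 * pred_pval PF))%type, (hta N q0), (hta_part PF M); split.
- exact: hta_hesitant.
- exact: hta_polarised.
- exact: hta_counter_free.
- exact: hta_visible.
move=> t; have D : in_dom t [::] by [].
apply: iff_trans (iff_sym (ssat_SE_PState phi D)) _.
apply: iff_trans (iff_sym (accepts_hta _ _ _)); apply: iff_sym.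
apply: (@sem_initE _ _ N M t sup p0) => //; first by rewrite leq_maxl.
by rewrite mem_head.
Qed.
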